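(* Let $L>0$ and let $\Phi$ be a monotone element of $\mathcal{D}_L(S,\omega)$ which is different from the identity and has zero flux. If $\mathrm{CAL}(\Phi)\leq 0$, then $\Phi$ has a fixed point in the interior of $S$ with negative action. If $\mathrm{CAL}(\Phi)\geq 0$, then $\Phi$ has a fixed point in the interior of $S$ with positive action.
   Context: Let $S:=\mathbb{R}\times[0,\pi]$ with coordinates $(x,y)$, and set $\omega:=\sin y\,dx\wedge dy$ and $\lambda:=\cos y\,dx$, so that $d\lambda=\omega$. For $L>0$, $\mathcal{D}_L(S,\omega)$ is the group of all (smooth) diffeomorphisms $\Phi:S\to S$ such that: (i) $\Phi(x+L,y)=(L,0)+\Phi(x,y)$ for all $(x,y)\in S$; (ii) $\Phi$ maps each component of $\partial S$ into itself; (iii) $\Phi^*\omega=\omega$. Write $\Phi=(X,Y)$. The flux of $\Phi$ is \[ \mathrm{FLUX}(\Phi):=\frac{1}{2L}\iint_{[0,L]\times[0,\pi]}(X(x,y)-x)\,\omega(x,y). \] The action of $\Phi$ is the unique smooth function $\sigma:S\to\mathbb{R}$ such that $d\sigma=\Phi^*\lambda-\lambda$ on $S$ and $\sigma(0,0)=\int_{\gamma_0}\lambda-\mathrm{FLUX}(\Phi)$, where $\gamma_0$ is a smooth path in $\partial S$ from $(0,0)$ to $\Phi(0,0)$. The action of a point $w\in S$ is $\sigma(w)$. If $\mathrm{FLUX}(\Phi)=0$, the Calabi invariant of $\Phi$ is \[ \mathrm{CAL}(\Phi):=\frac{1}{2L}\iint_{[0,L]\times[0,\pi]}\sigma\,\omega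 . \] The map $\Phi=(X,Y)$ is called monotone if $D_2Y(x,y)=\partial Y/\partial y\,(x,y)>0$ for every $(x,y)\in S$. *)

(* Defs.v *)
From Stdlib Require Import Reals Lra.
From Coquelicot Require Import Coquelicot.
Open Scope R_scope.

(* Maps S -> S and functions S -> R on the closed strip S = R x [0,PI] are
   represented by total maps on R * R; only their values on S are ever used. *)

Definition strip (p : R * R) : Prop := 0 <= snd p <= PI.
Definition strip_interior (p : R * R) : Prop := 0 < snd p < PI.
Definition strip_boundary (p : R * R) : Prop := snd p = 0 \/ snd p = PI.

Definition smooth_plane (g : R -> R -> R) : Prop :=
  forall (n : nat) (x y : R), ex_diff_n g n x y.

(* Smoothness up to the boundary: S is closed in the plane, and a function is
   smooth on S when it is the restriction of a C^infty function of the plane. *)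
Definition smooth_strip (f : R * R -> R) : Prop :=
  exists g : R -> R -> R,
    smooth_plane g /\ forall p, strip p -> f p = g (fst p) (snd p).

Definition smooth_map_strip (Phi : R * R -> R * R) : Prop :=
  smooth_strip (fun p => fst (Phi p)) /\ smooth_strip (fun p => snd (Phi p)).

Definition D1 (f : R * R -> R) (p : R * R) : R :=
  Derive (fun t => f (t, snd p)) (fst p).

(* The increment h is restricted so that the point stays in S: the derivative
   is two-sided in the interior and one-sided on the boundary. *)
Definition D2 (f : R * R -> R) (p : R * R) : R :=
  iota (fun l : R =>
    filterlim (fun h => (f (fst p, snd p + h) - f p) / h)
      (within (fun h => h <> 0 /\ strip (fst p, snd p + h)) (locally 0))
      (locally l)).

Lemma strip_increment_proper (p : R * R) : strip p ->
  ProperFilter'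
    (within (fun h => h <> 0 /\ strip (fst p, snd p + h)) (locally 0)).
Proof.
  intros Hp. split.
  2: { apply within_filter, locally_filter. }
  intros [e He].
  assert (Pi := PI_RGT_0). assert (Ee := cond_pos e).
  unfold strip in *; simpl in *.
  destruct (Rlt_dec (snd p) PI) as [H|H].
  - set (h := Rmin (e / 2) (PI - snd p)).
    assert (h <= e / 2) by apply Rmin_l.
    assert (h <= PI - snd p) by apply Rmin_r.
    assert (0 < h) by (apply Rmin_glb_lt; lra).
    apply (He h); [|lra].
    change (Rabs (h - 0) < e). rewrite Rabs_pos_eq; lra.
  - set (h := Rmin (e / 2) PI).
    assert (h <= e / 2) by apply Rmin_l.
    assert (h <= PI) by apply Rmin_r.
    assert (0 < h) by (apply Rmin_glb_lt; lra).
    apply (He (- h)); [|lra].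
    change (Rabs (- h - 0) < e). rewrite Rabs_left; lra.
Qed.

Lemma D2_extension (f : R * R -> R) (g : R -> R -> R) (p : R * R) :
  (forall q, strip q -> f q = g (fst q) (snd q)) -> strip p ->
  ex_derive (fun t => g (fst p) t) (snd p) ->
  D2 f p = Derive (fun t => g (fst p) t) (snd p).
Proof.
  intros Hfg Hp Hg.
  apply (@iota_filterlim_locally _ R_CompleteNormedModule _ _
           (strip_increment_proper p Hp)).
  apply Derive_correct, is_derive_Reals in Hg.
  intros P [e He].
  destruct (Hg e (cond_pos e)) as [d Hd].
  exists d. intros h Hh [h0 Hs].
  apply He.
  rewrite (Hfg p Hp), (Hfg _ Hs). cbn [fst snd].
  apply (Hd h h0).
  replace h with (h - 0) by ring. exact Hh.
Qed.

(* Integral over [0,L] x [0,PI] of f omega, where omega = sin y dx /\ dy,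
   written as an iterated integral; integrands below are continuous. *)
Definition omega_integral (L : R) (f : R * R -> R) : R :=
  RInt (fun x => RInt (fun y => f (x, y) * sin y) 0 PI) 0 L.

Definition diffeo_strip (Phi : R * R -> R * R) : Prop :=
  (forall p, strip p -> strip (Phi p)) /\
  smooth_map_strip Phi /\
  exists Psi : R * R -> R * R,
    (forall p, strip p -> strip (Psi p)) /\
    smooth_map_strip Psi /\
    (forall p, strip p -> Psi (Phi p) = p) /\
    (forall p, strip p -> Phi (Psi p) = p).

(* Phi^* omega = sin Y (D1 X D2 Y - D2 X D1 Y) dx /\ dy for Phi = (X, Y). *)
Definition preserves_omega (Phi : R * R -> R * R) : Prop :=
  let X := fun p => fst (Phi p) in
  let Y := fun p => snd (Phi p) in
  forall p, strip p ->
    sin (Y p) * (D1 X p * D2 Y p - D2 X p * D1 Y p) = sin (snd p).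

Record in_DL (L : R) (Phi : R * R -> R * R) : Prop := {
  DL_diffeo : diffeo_strip Phi;
  DL_equivariant : forall x y, strip (x, y) ->
    Phi (x + L, y) = (L + fst (Phi (x, y)), snd (Phi (x, y)));
  DL_lower : forall x, snd (Phi (x, 0)) = 0;
  DL_upper : forall x, snd (Phi (x, PI)) = PI;
  DL_omega : preserves_omega Phi
}.

Definition monotone (Phi : R * R -> R * R) : Prop :=
  forall p, strip p -> 0 < D2 (fun q => snd (Phi q)) p.

Definition FLUX (L : R) (Phi : R * R -> R * R) : R :=
  / (2 * L) * omega_integral L (fun p => fst (Phi p) - fst p).

Definition smooth_curve (gamma : R -> R * R) : Prop :=
  forall (n : nat) (t : R),
    ex_derive_n (fun s => fst (gamma s)) n t /\
    ex_derive_n (fun s => snd (gamma s)) n t.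

Definition boundary_path (gamma : R -> R * R) (p q : R * R) : Prop :=
  smooth_curve gamma /\
  (forall t, 0 <= t <= 1 -> strip_boundary (gamma t)) /\
  gamma 0 = p /\ gamma 1 = q.

(* Line integral of lambda = cos y dx along gamma restricted to [0,1]. *)
Definition lambda_integral (gamma : R -> R * R) : R :=
  RInt (fun t => cos (snd (gamma t)) * Derive (fun s => fst (gamma s)) t) 0 1.

(* sigma is the action of Phi. The two derivative clauses are the components of
   d sigma = Phi^* lambda - lambda, where
   Phi^* lambda = cos Y (D1 X dx + D2 X dy).
   These conditions determine sigma on S. *)
Record is_action (L : R) (Phi : R * R -> R * R) (sigma : R * R -> R) : Prop := {
  action_smooth : smooth_strip sigma;
  action_D1 : forall p, strip p ->
    D1 sigma p =
      cos (snd (Phi p)) * D1 (fun q => fst (Phi q)) p - cos (snd p);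
  action_D2 : forall p, strip p ->
    D2 sigma p = cos (snd (Phi p)) * D2 (fun q => fst (Phi q)) p;
  action_base : exists gamma0 : R -> R * R,
    boundary_path gamma0 (0, 0) (Phi (0, 0)) /\
    sigma (0, 0) = lambda_integral gamma0 - FLUX L Phi
}.

(* The Calabi invariant of a zero-flux map, as a function of its action. *)
Definition CAL (L : R) (sigma : R * R -> R) : R :=
  / (2 * L) * omega_integral L sigma.

(* Main.v *)
(** Put [a = X - x] and [W = sigma - a cos Y], the generating function of [Phi]
    written in the coordinates [(x, y)]. Then
      [dW = (cos Y - cos y) dx + a sin Y dY],
    so, by monotonicity, the interior critical points of [W] are exactly the
    interior fixed points of [Phi], and there [W = sigma]. [W] vanishes on [y = 0]
    by the normalisation of [sigma] and is constant on [y = PI]. Writing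
    [sin y dx dy] as [Phi^* omega], one finds that [(a sin y - D2 W) dx dy] and
    [(sigma sin y - W (sin y + sin Y D2 Y)) dx dy] are exact on the annulus, with
    primitives given by [a^2], [Y] and [W]. Integrating the first, zero flux gives
    [W = 0] on [y = PI]; integrating the second, CAL is the integral of [W] against a
    density positive in the interior. Hence if CAL <= 0 then [W < 0] somewhere
    (otherwise [W = 0] and [Phi = id]), and the minimum of [W] is the required fixed
    point; if CAL >= 0, argue with the maximum. *)
Require Import Defs.
From Stdlib Require Import Reals ZArith Lra Lia ClassicalEpsilon.
From Coquelicot Require Import Coquelicot.
Open Scope R_scope.

(** * Continuity of functions of two variables *)

Definition continuous_plane (f : R -> R -> R) : Prop :=
  forall x y, continuity_2d_pt f x y.

Lemma continuous_plane_const (c : R) : continuous_plane (fun _ _ => c).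
Proof. intros x y; apply continuity_2d_pt_const. Qed.

Lemma continuous_plane_fst : continuous_plane (fun x _ => x).
Proof. intros x y; apply continuity_2d_pt_id1. Qed.

Lemma continuous_plane_snd : continuous_plane (fun _ y => y).
Proof. intros x y; apply continuity_2d_pt_id2. Qed.

Lemma continuous_plane_plus (f g : R -> R -> R) :
  continuous_plane f -> continuous_plane g ->
  continuous_plane (fun x y => f x y + g x y).
Proof. intros Hf Hg x y; now apply continuity_2d_pt_plus. Qed.

Lemma continuous_plane_minus (f g : R -> R -> R) :
  continuous_plane f -> continuous_plane g ->
  continuous_plane (fun x y => f x y - g x y).
Proof. intros Hf Hg x y; now apply continuity_2d_pt_minus. Qed.

Lemma continuous_plane_opp (f : R -> R -> R) :
  continuous_plane f -> continuous_plane (fun x y => - f x y).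
Proof. intros Hf x y; now apply continuity_2d_pt_opp. Qed.

Lemma continuous_plane_mult (f g : R -> R -> R) :
  continuous_plane f -> continuous_plane g ->
  continuous_plane (fun x y => f x y * g x y).
Proof. intros Hf Hg x y; now apply continuity_2d_pt_mult. Qed.

Lemma continuous_plane_comp (h : R -> R) (f : R -> R -> R) :
  continuity h -> continuous_plane f -> continuous_plane (fun x y => h (f x y)).
Proof.
  intros Hh Hf x y. apply continuity_1d_2d_pt_comp; [apply Hh | apply Hf].
Qed.

Lemma continuous_plane_sin (f : R -> R -> R) :
  continuous_plane f -> continuous_plane (fun x y => sin (f x y)).
Proof. apply continuous_plane_comp, continuity_sin. Qed.

Lemma continuous_plane_cos (f : R -> R -> R) :
  continuous_plane f -> continuous_plane (fun x y => cos (f x y)).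
Proof. apply continuous_plane_comp, continuity_cos. Qed.

Lemma continuous_plane_1 (f : R -> R -> R) (x y : R) :
  continuous_plane f -> continuous (fun t => f t y) x.
Proof.
  intros Hf. apply continuity_pt_filterlim.
  intros e He. destruct (Hf x y (mkposreal e He)) as [d Hd].
  exists d; split; [apply cond_pos|].
  intros t [_ Ht]. apply Hd; [exact Ht|].
  rewrite Rminus_diag, Rabs_R0. apply cond_pos.
Qed.

Lemma continuous_plane_2 (f : R -> R -> R) (x y : R) :
  continuous_plane f -> continuous (fun t => f x t) y.
Proof.
  intros Hf. apply continuity_pt_filterlim.
  intros e He. destruct (Hf x y (mkposreal e He)) as [d Hd].
  exists d; split; [apply cond_pos|].
  intros t [_ Ht]. apply Hd; [|exact Ht].
  rewrite Rminus_diag, Rabs_R0. apply cond_pos.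
Qed.

Lemma ex_RInt_plane_2 (f : R -> R -> R) (x a b : R) :
  continuous_plane f -> ex_RInt (fun y => f x y) a b.
Proof.
  intros Hf. apply (ex_RInt_continuous (V := R_CompleteNormedModule)).
  intros z _. now apply continuous_plane_2.
Qed.

(** By uniform continuity on [[x-1,x+1] x [a,b]], nearby slices differ by less than
    [e / (2 * (b - a))] for every [y], so their integrals differ by at most [e / 2]. *)
Lemma continuous_RInt_plane (f : R -> R -> R) (a b x : R) :
  a < b -> continuous_plane f -> continuous (fun t => RInt (f t) a b) x.
Proof.
  intros Hab Hf. apply continuity_pt_filterlim.
  intros e He.
  assert (He' : 0 < e / (2 * (b - a))) by (apply Rdiv_lt_0_compat; lra).
  destruct (uniform_continuity_2d f (x - 1) (x + 1) a b
              (fun u v _ _ => Hf u v) (mkposreal _ He')) as [d Hd].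
  assert (Pd := cond_pos d).
  exists (Rmin d 1). split; [apply Rmin_glb_lt; lra|].
  intros t [_ Ht]. simpl in Ht |- *. unfold Rdist in *.
  assert (Ht1 : Rabs (t - x) < d) by (eapply Rlt_le_trans; [exact Ht|apply Rmin_l]).
  assert (Ht2 : Rabs (t - x) < 1) by (eapply Rlt_le_trans; [exact Ht|apply Rmin_r]).
  apply Rabs_def2 in Ht2.
  assert (I : forall u, ex_RInt (fun y => f u y) a b)
    by (intros u; now apply ex_RInt_plane_2).
  assert (E : RInt (f t) a b - RInt (f x) a b = RInt (fun y => f t y - f x y) a b).
  { symmetry. apply (RInt_minus (f t) (f x)); apply I. }
  rewrite E.
  apply Rle_lt_trans with ((b - a) * (e / (2 * (b - a)))).
  2: { replace ((b - a) * (e / (2 * (b - a)))) with (e / 2) by (field; lra). lra. }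
  apply (norm_RInt_le_const (V := R_CompleteNormedModule)
           (fun y => f t y - f x y) a b _ (e / (2 * (b - a)))); [lra| |].
  - intros y Hy. left. apply Hd; try lra.
    rewrite Rminus_diag, Rabs_R0; exact Pd.
  - apply (@RInt_correct R_CompleteNormedModule).
    apply (@ex_RInt_minus R_NormedModule); apply I.
Qed.

(** * Integrals over one period rectangle, minima, and Green's formula *)

Definition dint (L : R) (f : R -> R -> R) : R :=
  RInt (fun x => RInt (fun y => f x y) 0 PI) 0 L.

Lemma dint_ext (L : R) (f g : R -> R -> R) :
  (forall x y, 0 < y < PI -> f x y = g x y) -> dint L f = dint L g.
Proof.
  intros H. assert (Pi := PI_RGT_0).
  apply RInt_ext; intros x _. apply RInt_ext; intros y Hy.
  rewrite Rmin_left, Rmax_right in Hy by lra. now apply H.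
Qed.

Lemma dint_plus (L : R) (f g : R -> R -> R) :
  continuous_plane f -> continuous_plane g ->
  dint L (fun x y => f x y + g x y) = dint L f + dint L g.
Proof.
  intros Hf Hg. assert (Pi := PI_RGT_0). unfold dint.
  rewrite <- (RInt_plus (V := R_CompleteNormedModule)).
  - apply RInt_ext; intros x _.
    apply (RInt_plus (V := R_CompleteNormedModule)); now apply ex_RInt_plane_2.
  - apply (ex_RInt_continuous (V := R_CompleteNormedModule)).
    intros z _. now apply continuous_RInt_plane.
  - apply (ex_RInt_continuous (V := R_CompleteNormedModule)).
    intros z _. now apply continuous_RInt_plane.
Qed.

(** By continuity, a positive value persists on an interval of positive length, which would make the
    integral positive. *)
Lemma RInt_nonneg_eq_0 (g : R -> R) (a b : R) :
  a < b -> (forall x, continuous g x) -> (forall x, a <= x <= b -> 0 <= g x) ->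
  RInt g a b <= 0 -> forall x, a <= x <= b -> g x = 0.
Proof.
  intros Hab Hc Hp HI x Hx.
  destruct (Hp x Hx) as [Hg|Hg]; [exfalso|now symmetry].
  assert (Hpt : continuity_pt g x) by (apply continuity_pt_filterlim, Hc).
  destruct (Hpt (g x) Hg) as [d [Pd Hd]].
  assert (Hd' : forall t, Rabs (t - x) < d -> 0 < g t).
  { intros t Ht. destruct (Req_dec t x) as [->|Hne]; [exact Hg|].
    assert (K := Hd t (conj (conj I (not_eq_sym Hne)) Ht)).
    simpl in K; unfold Rdist in K. apply Rabs_def2 in K. lra. }
  (* Clipping to [[a,b]] keeps a nondegenerate interval even when [x] is an endpoint. *)
  set (u := Rmax a (x - d / 2)). set (v := Rmin b (x + d / 2)).
  assert (a <= u /\ x - d / 2 <= u) by (split; [apply Rmax_l|apply Rmax_r]).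
  assert (v <= b /\ v <= x + d / 2) by (split; [apply Rmin_l|apply Rmin_r]).
  assert (u < v) by (apply Rmax_lub_lt; apply Rmin_glb_lt; lra).
  assert (J : forall p q, ex_RInt g p q).
  { intros p q. apply (ex_RInt_continuous (V := R_CompleteNormedModule)). intros; apply Hc. }
  assert (E1 := RInt_Chasles g a u b (J _ _) (J _ _)).
  assert (E2 := RInt_Chasles g u v b (J _ _) (J _ _)).
  unfold plus in E1, E2; simpl in E1, E2.
  assert (0 <= RInt g a u) by (apply RInt_ge_0; [lra|apply J|intros; apply Hp; lra]).
  assert (0 <= RInt g v b) by (apply RInt_ge_0; [lra|apply J|intros; apply Hp; lra]).
  assert (0 < RInt g u v).
  { apply RInt_gt_0; [lra| |intros; apply Hc].
    intros t Ht. apply Hd', Rabs_def1; lra. }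
  lra.
Qed.

Lemma dint_nonneg_eq_0 (L : R) (f : R -> R -> R) :
  0 < L -> continuous_plane f ->
  (forall x y, 0 <= x <= L -> 0 <= y <= PI -> 0 <= f x y) ->
  dint L f <= 0 ->
  forall x y, 0 <= x <= L -> 0 <= y <= PI -> f x y = 0.
Proof.
  intros HL Hf Hp HI x y Hx Hy. assert (Pi := PI_RGT_0).
  apply (RInt_nonneg_eq_0 (fun t => f x t) 0 PI); auto.
  { intros t; now apply continuous_plane_2. }
  apply Req_le.
  apply (RInt_nonneg_eq_0 (fun t => RInt (fun y => f t y) 0 PI) 0 L); auto.
  { intros t; now apply continuous_RInt_plane. }
  intros t Ht. apply RInt_ge_0; [lra|now apply ex_RInt_plane_2|].
  intros z Hz; apply Hp; lra.
Qed.

(** Each vertical slice is minimised first, then the slice minimum is minimised over [x]. The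
    minimiser [m] may jump, but the value [f x (m x)] is continuous because [f] is uniformly
    continuous near the slice. *)
Lemma rectangle_min (f : R -> R -> R) (a b c d : R) :
  a <= b -> c <= d -> continuous_plane f ->
  exists x0 y0, a <= x0 <= b /\ c <= y0 <= d /\
    forall x y, a <= x <= b -> c <= y <= d -> f x0 y0 <= f x y.
Proof.
  intros Hab Hcd Hf.
  assert (Hm : forall x, exists y0,
    (forall y, c <= y <= d -> f x y0 <= f x y) /\ c <= y0 <= d).
  { intros x. apply (continuity_ab_min (fun y => f x y)); [exact Hcd|].
    intros y _. now apply continuity_pt_filterlim, continuous_plane_2. }
  set (m := fun x => proj1_sig (constructive_indefinite_description _ (Hm x))).
  assert (Em : forall x, (forall y, c <= y <= d -> f x (m x) <= f x y) /\ c <= m x <= d)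
    by (intros x; exact (proj2_sig (constructive_indefinite_description _ (Hm x)))).
  destruct (continuity_ab_min (fun x => f x (m x)) a b Hab) as [x0 [Hx0 Hx]].
  - intros x _ e He.
    destruct (uniform_continuity_2d f (x - 1) (x + 1) c d
                (fun u v _ _ => Hf u v) (mkposreal e He)) as [dl Hd].
    assert (Pd := cond_pos dl).
    exists (Rmin dl 1). split; [apply Rmin_glb_lt; lra|].
    intros t [_ Ht]. simpl in Ht |- *. unfold Rdist in *.
    assert (Ht1 : Rabs (t - x) < dl) by (eapply Rlt_le_trans; [exact Ht|apply Rmin_l]).
    assert (Ht2 : Rabs (t - x) < 1) by (eapply Rlt_le_trans; [exact Ht|apply Rmin_r]).
    apply Rabs_def2 in Ht2.
    assert (K : forall y, c <= y <= d -> Rabs (f t y - f x y) < e).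
    { intros y Hy. apply Hd; try lra. rewrite Rminus_diag, Rabs_R0; exact Pd. }
    destruct (Em t) as [Et It]. destruct (Em x) as [Ex Ix].
    assert (K1 := K _ It). assert (K2 := K _ Ix).
    apply Rabs_def2 in K1, K2.
    assert (K3 := Et _ Ix). assert (K4 := Ex _ It).
    apply Rabs_def1; lra.
  - exists x0, (m x0). destruct (Em x0) as [_ I0].
    split; [exact Hx|split; [exact I0|]].
    intros x y Hx' Hy'. destruct (Em x) as [Ex _].
    eapply Rle_trans; [apply (Hx0 x Hx')|now apply Ex].
Qed.

(** Green's formula on the annulus for the form [Q dx + P dy]: the sides [x = 0] and [x = L] cancel
    by periodicity of [P], and the two boundary circles contribute [k] for each [x]. *)
Lemma green (L k : R) (P Q Px Qy : R -> R -> R) :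
  continuous_plane P -> continuous_plane Px -> continuous_plane Qy ->
  (forall x y, is_derive (fun t => P t y) x (Px x y)) ->
  (forall x y, is_derive (fun t => Q x t) y (Qy x y)) ->
  (forall y, 0 < y < PI -> P L y = P 0 y) ->
  (forall x, Q x PI - Q x 0 = k) ->
  dint L (fun x y => Px x y - Qy x y) = - (L * k).
Proof.
  intros CP CPx CQy DP DQ PP QQ. assert (Pi := PI_RGT_0). unfold dint.
  set (F := fun x => RInt (fun y => P x y) 0 PI).
  set (dF := fun x => RInt (fun y => Px x y) 0 PI).
  (* Differentiation under the integral sign. *)
  assert (DF : forall x, is_derive F x (dF x)).
  { intros x. unfold dF.
    replace (RInt (fun y => Px x y) 0 PI)
      with (RInt (fun t => Derive (fun u => P u t) x) 0 PI).
    2: { apply RInt_ext; intros y _. apply is_derive_unique, DP. }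
    apply (is_derive_RInt_param P 0 PI x).
    - apply filter_forall; intros u t _. eexists; apply DP.
    - intros t _. apply (continuity_2d_pt_ext Px); [|apply CPx].
      intros u v; symmetry; apply is_derive_unique, DP.
    - apply filter_forall; intros u. now apply (ex_RInt_plane_2 P). }
  assert (E : forall x, RInt (fun y => Px x y - Qy x y) 0 PI = dF x - k).
  { intros x. unfold dF. rewrite <- (QQ x).
    rewrite <- (is_RInt_unique (fun y => Qy x y) 0 PI (Q x PI - Q x 0)).
    - apply (RInt_minus (fun y => Px x y) (fun y => Qy x y)); now apply ex_RInt_plane_2.
    - apply (is_RInt_derive (fun y => Q x y)); intros; [apply DQ|now apply continuous_plane_2]. }
  rewrite (RInt_ext _ (fun x => dF x - k)) by (intros; apply E).
  assert (E0 : F L = F 0).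
  { apply RInt_ext. intros y Hy. rewrite Rmin_left, Rmax_right in Hy by lra. now apply PP. }
  apply is_RInt_unique.
  replace (- (L * k)) with ((F L - F 0) - (L - 0) * k) by (rewrite E0; ring).
  apply (is_RInt_minus dF (fun _ => k)).
  - apply (is_RInt_derive F); intros; [apply DF|].
    unfold dF. now apply continuous_RInt_plane.
  - apply (is_RInt_const 0 L k).
Qed.

(** * Reduction to one period *)

Lemma periodic_shift (L : R) (f : R -> R) :
  (forall x, f (x + L) = f x) -> forall (n : Z) x, f (x + IZR n * L) = f x.
Proof.
  intros Hf.
  assert (Hn : forall (n : nat) x, f (x + INR n * L) = f x).
  { induction n as [|n IH]; intros x.
    - f_equal. simpl; ring.
    - rewrite S_INR, <- (IH x), <- (Hf (x + INR n * L)). f_equal; ring. }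
  intros n x. destruct (Z_le_gt_dec 0 n) as [H|H].
  - rewrite <- (Z2Nat.id n H), <- INR_IZR_INZ. apply Hn.
  (* A negative shift is undone by the opposite natural one. *)
  - rewrite <- (Hn (Z.to_nat (- n)) (x + IZR n * L)). f_equal.
    rewrite INR_IZR_INZ, Z2Nat.id by lia. rewrite opp_IZR. ring.
Qed.

Lemma shift_to_period (L x : R) :
  0 < L -> exists n : Z, 0 <= x + IZR n * L <= L.
Proof.
  intros HL. exists (- Int_part (x / L))%Z.
  destruct (base_Int_part (x / L)) as [H1 H2].
  assert (E : x = x / L * L) by (field; lra).
  rewrite opp_IZR. set (z := IZR (Int_part _)) in *. set (q := x / L) in *.
  clearbody z q. rewrite E. split; nra.
Qed.

(** * Partial derivatives and one-variable calculus *)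

Definition dx (f : R -> R -> R) (x y : R) : R := Derive (fun t => f t y) x.
Definition dy (f : R -> R -> R) (x y : R) : R := Derive (fun t => f x t) y.

Lemma smooth_plane_continuous (f : R -> R -> R) :
  smooth_plane f -> continuous_plane f.
Proof. intros H x y. exact (proj1 (H 0%nat x y)). Qed.

Lemma smooth_plane_is_derive_dx (f : R -> R -> R) (x y : R) :
  smooth_plane f -> is_derive (fun t => f t y) x (dx f x y).
Proof. intros H. apply Derive_correct. apply (H 1%nat x y). Qed.

Lemma smooth_plane_is_derive_dy (f : R -> R -> R) (x y : R) :
  smooth_plane f -> is_derive (fun t => f x t) y (dy f x y).
Proof. intros H. apply Derive_correct. apply (H 1%nat x y). Qed.

Lemma smooth_plane_dx (f : R -> R -> R) : smooth_plane f -> smooth_plane (dx f).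
Proof. intros H n x y. apply (H (S n) x y). Qed.

Lemma smooth_plane_dy (f : R -> R -> R) : smooth_plane f -> smooth_plane (dy f).
Proof. intros H n x y. apply (H (S n) x y). Qed.

Lemma dx_dy_comm (f : R -> R -> R) (x y : R) :
  smooth_plane f -> dx (dy f) x y = dy (dx f) x y.
Proof.
  intros H. assert (Hx := smooth_plane_dx f H). assert (Hy := smooth_plane_dy f H).
  apply (Schwarz f x y).
  - apply locally_2d_forall. intros u v.
    split; [apply (H 1%nat u v)|]. split; [apply (H 1%nat u v)|].
    split; [apply (Hy 1%nat u v)|apply (Hx 1%nat u v)].
  - apply (smooth_plane_dx _ Hy 0%nat).
  - apply (smooth_plane_dy _ Hx 0%nat).
Qed.

Ltac continuous_plane_tac :=
  repeat first
    [ assumption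
    | apply continuous_plane_const
    | apply continuous_plane_fst
    | apply continuous_plane_snd
    | apply continuous_plane_minus
    | apply continuous_plane_plus
    | apply continuous_plane_mult
    | apply continuous_plane_opp
    | apply continuous_plane_sin
    | apply continuous_plane_cos ].

(** Restricted to horizontal and vertical lines, this gives both partial derivatives of
    [W = s - a cos B]. *)
Lemma is_derive_primitive_1d (s a b : R -> R) (x ds da db : R) :
  is_derive s x ds -> is_derive a x da -> is_derive b x db ->
  is_derive (fun t => s t - a t * cos (b t)) x
    (ds - da * cos (b x) + a x * sin (b x) * db).
Proof.
  intros Hs Ha Hb.
  auto_derive.
  - repeat split; eexists; eassumption.
  - rewrite (is_derive_unique (fun t : R => s t) _ _ Hs), (is_derive_unique (fun t : R => a t) _ _ Ha),
      (is_derive_unique (fun t : R => b t) _ _ Hb). ring.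
Qed.

(** Meant for the coefficients of the form [(a^2 / 2) g(B) dB]: [b] is [B] along a line and [c] one
    of its partial derivatives. *)
Lemma is_derive_green_1d (a b c g : R -> R) (x da db dc dg : R) :
  is_derive a x da -> is_derive b x db -> is_derive c x dc ->
  is_derive g (b x) dg ->
  is_derive (fun t => a t ^ 2 / 2 * g (b t) * c t) x
    (a x * da * g (b x) * c x
     + a x ^ 2 / 2 * (dg * db * c x + g (b x) * dc)).
Proof.
  intros Ha Hb Hc Hg.
  auto_derive.
  - repeat split; eexists; eassumption.
  - rewrite (is_derive_unique (fun t : R => a t) _ _ Ha), (is_derive_unique (fun t : R => b t) _ _ Hb),
      (is_derive_unique (fun t : R => c t) _ _ Hc), (is_derive_unique (fun t : R => g t) _ _ Hg). field.
Qed.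

Lemma const_of_is_derive_0 (f : R -> R) (x : R) :
  (forall t, is_derive f t 0) -> f x = f 0.
Proof.
  intros Hf.
  destruct (MVT_gen f 0 x (fun _ => 0)) as [c [_ Hc]].
  - intros; apply Hf.
  - intros t _. apply continuity_pt_filterlim, (ex_derive_continuous f).
    eexists; apply Hf.
  - lra.
Qed.

Lemma is_derive_local_min (f : R -> R) (x l : R) :
  is_derive f x l -> locally x (fun t => f x <= f t) -> l = 0.
Proof.
  intros Hd [d Hm]. assert (Pd := cond_pos d).
  apply is_derive_Reals in Hd.
  rewrite <- (derive_pt_eq_0 f x l (exist _ l Hd) Hd).
  apply (deriv_minimum f (x - d) (x + d) x); try lra.
  intros t H1 H2. apply Hm. apply Rabs_def1; unfold minus, plus, opp; simpl; lra.
Qed.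

(** * The generating function and its boundary values *)

Section Strip.

(** [A], [B], [s] are plane extensions of [X], [Y] and the action. Off the strip they are arbitrary,
    so the geometric hypotheses are restricted to [0 <= y <= PI]. *)
Variables (L : R) (A B s : R -> R -> R).
Hypothesis HL : 0 < L.
Hypothesis smooth_A : smooth_plane A.
Hypothesis smooth_B : smooth_plane B.
Hypothesis smooth_s : smooth_plane s.
Hypothesis A_equivariant :
  forall x y, 0 <= y <= PI -> A (x + L) y = L + A x y.
Hypothesis B_periodic : forall x y, 0 <= y <= PI -> B (x + L) y = B x y.
Hypothesis B_lower : forall x, B x 0 = 0.
Hypothesis B_upper : forall x, B x PI = PI.
Hypothesis area : forall x y, 0 <= y <= PI ->
  sin (B x y) * (dx A x y * dy B x y - dy A x y * dx B x y) = sin y.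
Hypothesis B_monotone : forall x y, 0 <= y <= PI -> 0 < dy B x y.
Hypothesis s_dx : forall x y, 0 <= y <= PI ->
  dx s x y = cos (B x y) * dx A x y - cos y.
Hypothesis s_dy : forall x y, 0 <= y <= PI ->
  dy s x y = cos (B x y) * dy A x y.
Hypothesis s_base : s 0 0 = A 0 0.
Hypothesis flux_0 : dint L (fun x y => (A x y - x) * sin y) = 0.

Let a (x y : R) : R := A x y - x.

Let W (x y : R) : R := s x y - a x y * cos (B x y).
(** [Wx] and [Wy] are the partial derivatives of [W] on the whole plane; the equations for [ds]
    simplify them only on the strip. *)
Let Wx (x y : R) : R :=
  dx s x y - (dx A x y - 1) * cos (B x y) + a x y * sin (B x y) * dx B x y.
Let Wy (x y : R) : R :=
  dy s x y - dy A x y * cos (B x y) + a x y * sin (B x y) * dy B x y.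

Let CA : continuous_plane A := smooth_plane_continuous _ smooth_A.
Let CB : continuous_plane B := smooth_plane_continuous _ smooth_B.
Let Cs : continuous_plane s := smooth_plane_continuous _ smooth_s.
Let CAx : continuous_plane (dx A) :=
  smooth_plane_continuous _ (smooth_plane_dx _ smooth_A).
Let CAy : continuous_plane (dy A) :=
  smooth_plane_continuous _ (smooth_plane_dy _ smooth_A).
Let CBx : continuous_plane (dx B) :=
  smooth_plane_continuous _ (smooth_plane_dx _ smooth_B).
Let CBy : continuous_plane (dy B) :=
  smooth_plane_continuous _ (smooth_plane_dy _ smooth_B).
Let CBxy : continuous_plane (dx (dy B)) :=
  smooth_plane_continuous _ (smooth_plane_dx _ (smooth_plane_dy _ smooth_B)).
Let CByx : continuous_plane (dy (dx B)) :=
  smooth_plane_continuous _ (smooth_plane_dy _ (smooth_plane_dx _ smooth_B)).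
Let Csy : continuous_plane (dy s) :=
  smooth_plane_continuous _ (smooth_plane_dy _ smooth_s).

Lemma continuous_displacement : continuous_plane a.
Proof. unfold a. continuous_plane_tac. Qed.
Let Ca := continuous_displacement.

Lemma continuous_W : continuous_plane W.
Proof. unfold W. continuous_plane_tac. Qed.
Let CW := continuous_W.

Lemma continuous_Wy : continuous_plane Wy.
Proof. unfold Wy. continuous_plane_tac. Qed.
Let CWy := continuous_Wy.

Lemma is_derive_displacement_1 (x y : R) :
  is_derive (fun t => a t y) x (dx A x y - 1).
Proof.
  apply (is_derive_minus (fun t => A t y) (fun t => t)).
  - now apply smooth_plane_is_derive_dx.
  - exact (is_derive_id (K := R_AbsRing) x).
Qed.

Lemma is_derive_displacement_2 (x y : R) :
  is_derive (fun t => a x t) y (dy A x y).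
Proof.
  replace (dy A x y) with (dy A x y - 0) by ring.
  apply (is_derive_minus (fun t => A x t) (fun _ => x)).
  - now apply smooth_plane_is_derive_dy.
  - apply (is_derive_const x).
Qed.

Lemma is_derive_W_1 (x y : R) : is_derive (fun t => W t y) x (Wx x y).
Proof.
  apply (is_derive_primitive_1d (fun t => s t y) (fun t => a t y) (fun t => B t y));
    [now apply smooth_plane_is_derive_dx | apply is_derive_displacement_1
    | now apply smooth_plane_is_derive_dx].
Qed.

Lemma is_derive_W_2 (x y : R) : is_derive (fun t => W x t) y (Wy x y).
Proof.
  apply (is_derive_primitive_1d (fun t => s x t) (fun t => a x t) (fun t => B x t));
    [now apply smooth_plane_is_derive_dy | apply is_derive_displacement_2
    | now apply smooth_plane_is_derive_dy].
Qed.

Lemma Wx_strip (x y : R) : 0 <= y <= PI ->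
  Wx x y = cos (B x y) - cos y + a x y * sin (B x y) * dx B x y.
Proof. intros Hy. unfold Wx. rewrite s_dx by exact Hy. ring. Qed.

Lemma Wy_strip (x y : R) : 0 <= y <= PI ->
  Wy x y = a x y * sin (B x y) * dy B x y.
Proof. intros Hy. unfold Wy. rewrite s_dy by exact Hy. ring. Qed.

(** On [y = 0] the sine and the difference of cosines vanish, so [W] is constant there; [s_base]
    makes the constant zero. *)
Lemma W_lower (x : R) : W x 0 = 0.
Proof.
  assert (Pi := PI_RGT_0).
  rewrite (const_of_is_derive_0 (fun t => W t 0) x).
  - unfold W, a. rewrite B_lower, cos_0, s_base. ring.
  - intros t. assert (D := is_derive_W_1 t 0).
    rewrite Wx_strip, B_lower, sin_0 in D by lra.
    replace (cos 0 - cos 0 + _) with 0 in D by ring. exact D.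
Qed.

Lemma W_upper_const (x : R) : W x PI = W 0 PI.
Proof.
  assert (Pi := PI_RGT_0).
  apply (const_of_is_derive_0 (fun t => W t PI) x).
  intros t. assert (D := is_derive_W_1 t PI).
  rewrite Wx_strip, B_upper, sin_PI in D by lra.
  replace (cos PI - cos PI + _) with 0 in D by ring. exact D.
Qed.

Lemma displacement_periodic (x y : R) : 0 <= y <= PI -> a (x + L) y = a x y.
Proof. intros Hy. unfold a. rewrite A_equivariant by exact Hy. ring. Qed.

(** Periodicity of [B] is known only on the strip, so two-sided derivatives are compared at interior
    heights, where a whole neighbourhood lies in the strip. *)
Lemma dy_B_periodic (x y : R) : 0 < y < PI -> dy B (x + L) y = dy B x y.
Proof.
  intros Hy. apply Derive_ext_loc.
  apply (locally_interval _ y 0 PI); simpl; try lra.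
  intros t H1 H2. simpl in *. apply B_periodic; lra.
Qed.

(** Periodicity of [s] is not assumed; it is recovered here by integrating the periodic [Wy] upwards
    from [y = 0], where [W] vanishes. *)
Lemma W_periodic (x y : R) : 0 <= y <= PI -> W (x + L) y = W x y.
Proof.
  intros Hy. assert (Pi := PI_RGT_0).
  destruct (MVT_gen (fun t => W (x + L) t - W x t) 0 y (fun _ => 0)) as [c [_ Hc]].
  - intros t Ht. rewrite Rmin_left, Rmax_right in Ht by lra.
    replace 0 with (Wy (x + L) t - Wy x t).
    + apply (is_derive_minus (fun t => W (x + L) t) (fun t => W x t)); apply is_derive_W_2.
    + rewrite !Wy_strip, displacement_periodic, B_periodic, dy_B_periodic by lra. ring.
  - intros t _. apply continuity_pt_filterlim.
    apply (continuous_minus (fun t => W (x + L) t) (fun t => W x t));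
      now apply continuous_plane_2.
  - rewrite !W_lower in Hc. lra.
Qed.

(* The first summand is the exact form [d (a^2 / 2) /\ d (G o B)], with [G' = g]. *)
Lemma dint_exact (g g' : R -> R) (K Ky : R -> R -> R) (k : R) :
  (forall t, is_derive g t (g' t)) -> continuity g' ->
  g 0 = 0 -> g PI = 0 ->
  (forall x y, is_derive (fun t => K x t) y (Ky x y)) -> continuous_plane Ky ->
  (forall x, K x PI - K x 0 = k) ->
  dint L (fun x y =>
    a x y * g (B x y) * ((dx A x y - 1) * dy B x y - dy A x y * dx B x y) + Ky x y)
  = L * k.
Proof.
  intros Hg Cg' g0 gPI HK CKy Kk.
  assert (Cg : continuity g).
  { intros t. apply continuity_pt_filterlim, (ex_derive_continuous g). eexists; apply Hg. }
  assert (CgB := continuous_plane_comp g B Cg CB).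
  assert (Cg'B := continuous_plane_comp g' B Cg' CB).
  (* [Q dx + P dy] is the form [(a^2 / 2) g(B) dB]. In [Px - Qy] the [g'] terms cancel, and the
     mixed partials cancel by Schwarz. Since [g] vanishes at [0] and [PI], [Q] vanishes on the
     boundary. *)
  set (P := fun x y => a x y ^ 2 / 2 * g (B x y) * dy B x y).
  set (Q := fun x y => a x y ^ 2 / 2 * g (B x y) * dx B x y).
  set (Px := fun x y => a x y * (dx A x y - 1) * g (B x y) * dy B x y
     + a x y ^ 2 / 2 * (g' (B x y) * dx B x y * dy B x y + g (B x y) * dx (dy B) x y)).
  set (Qy := fun x y => a x y * dy A x y * g (B x y) * dx B x y
     + a x y ^ 2 / 2 * (g' (B x y) * dy B x y * dx B x y + g (B x y) * dy (dx B) x y)).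
  rewrite (dint_ext L _ (fun x y => Px x y - (Qy x y - Ky x y))).
  2: { intros x y _. unfold Px, Qy. rewrite dx_dy_comm by exact smooth_B. ring. }
  rewrite (green L (- k) P (fun x y => Q x y - K x y)); auto.
  - ring.
  - unfold P; simpl. unfold Rdiv. continuous_plane_tac.
  - unfold Px; simpl. unfold Rdiv. continuous_plane_tac.
  - unfold Qy; simpl. unfold Rdiv. continuous_plane_tac.
  - intros x y. unfold P, Px.
    apply (is_derive_green_1d (fun t => a t y) (fun t => B t y) (fun t => dy B t y) g);
      [apply is_derive_displacement_1 | | |apply Hg];
      apply smooth_plane_is_derive_dx; [|apply smooth_plane_dy]; exact smooth_B.
  - intros x y. apply (is_derive_minus (fun t => Q x t) (fun t => K x t)); [|apply HK].
    unfold Q, Qy.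
    apply (is_derive_green_1d (fun t => a x t) (fun t => B x t) (fun t => dx B x t) g);
      [apply is_derive_displacement_2 | | |apply Hg];
      apply smooth_plane_is_derive_dy; [|apply smooth_plane_dx]; exact smooth_B.
  - intros y Hy. unfold P. replace L with (0 + L) by ring.
    rewrite displacement_periodic, B_periodic, dy_B_periodic by lra. reflexivity.
  - intros x. unfold Q. rewrite B_lower, B_upper, g0, gPI, <- (Kk x). field.
Qed.

(** Take [g = sin] and [K = W] in [dint_exact]: by [area] the integrand is [a sin y], so zero flux
    equals [L] times the constant value of [W] on [y = PI]. *)
Lemma W_upper (x : R) : W x PI = 0.
Proof.
  assert (Pi := PI_RGT_0). rewrite W_upper_const.
  assert (H : dint L (fun x y => a x y * sin y) = L * W 0 PI).
  { rewrite <- (dint_exact sin cos W Wy (W 0 PI)); auto.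
    - apply dint_ext. intros u v Hv.
      rewrite Wy_strip, <- (area u v) by lra. ring.
    - intros t. apply is_derive_sin.
    - apply continuity_cos.
    - apply sin_0.
    - apply sin_PI.
    - apply is_derive_W_2.
    - intros u. rewrite W_lower, W_upper_const. ring. }
  assert (H0 : dint L (fun x y => a x y * sin y) = 0) by exact flux_0.
  nra.
Qed.

(** * The Calabi integral as a weighted integral of [W] *)

Let weight (x y : R) : R := sin y + sin (B x y) * dy B x y.

Lemma continuous_weight : continuous_plane weight.
Proof. unfold weight. continuous_plane_tac. Qed.

(** Take [g = sin cos] and [K = W cos B] in [dint_exact]. By [area] the integrand [E] equals
    [s sin y - W weight], and its integral is zero because [W] vanishes on both boundary lines. *)
Lemma calabi_eq :
  dint L (fun x y => s x y * sin y) = dint L (fun x y => W x y * weight x y).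
Proof.
  assert (Pi := PI_RGT_0).
  set (Ky := fun x y => Wy x y * cos (B x y) - W x y * sin (B x y) * dy B x y).
  set (E := fun x y => a x y * (sin (B x y) * cos (B x y))
    * ((dx A x y - 1) * dy B x y - dy A x y * dx B x y) + Ky x y).
  assert (HE : dint L E = L * 0).
  { apply (dint_exact (fun t => sin t * cos t) (fun t => cos t * cos t - sin t * sin t)
             (fun x y => W x y * cos (B x y)) Ky 0).
    - intros t. auto_derive; [exact I|ring].
    - apply continuity_minus; apply continuity_mult;
        first [apply continuity_cos | apply continuity_sin].
    - rewrite sin_0; ring.
    - rewrite sin_PI; ring.
    - intros x y.
      assert (H1 := is_derive_W_2 x y).
      assert (H2 := smooth_plane_is_derive_dy B x y smooth_B).
      set (w := fun t => W x t) in *. set (b := fun t => B x t) in *.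
      change (is_derive (fun t => w t * cos (b t)) y
                (Wy x y * cos (b y) - w y * sin (b y) * dy B x y)).
      auto_derive; [split; [eexists; exact H1|split; [eexists; exact H2|exact I]]|].
      rewrite (is_derive_unique (fun t : R => w t) _ _ H1), (is_derive_unique (fun t : R => b t) _ _ H2). ring.
    - unfold Ky. continuous_plane_tac.
    - intros x. rewrite W_upper, W_lower. ring. }
  rewrite (dint_ext L _ (fun x y => W x y * weight x y + E x y)).
  - rewrite dint_plus, HE; [ring| |].
    + apply continuous_plane_mult; [exact CW|apply continuous_weight].
    + unfold E, Ky. continuous_plane_tac.
  - intros x y Hy. unfold E, Ky, weight.
    rewrite Wy_strip by lra. unfold W. rewrite <- (area x y) by lra. ring.
Qed.

(** * Critical points, fixed points and the extremum argument *)

Lemma B_interior (x y : R) : 0 < y < PI -> 0 < B x y < PI.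
Proof.
  intros Hy.
  assert (M : forall u v, 0 <= u -> u < v -> v <= PI -> B x u < B x v).
  { intros u v H1 H2 H3.
    destruct (MVT_gen (fun t => B x t) u v (dy B x)) as [c [Hc Ec]].
    - intros t _. now apply smooth_plane_is_derive_dy.
    - intros t _. now apply continuity_pt_filterlim, continuous_plane_2.
    - rewrite Rmin_left, Rmax_right in Hc by lra.
      assert (K : 0 < dy B x c) by (apply B_monotone; lra). nra. }
  split; [rewrite <- (B_lower x)|rewrite <- (B_upper x)]; apply M; lra.
Qed.

(** In [Wy = a sin B dy B] the last two factors are positive, so [a = 0]. Then [Wx] reduces to
    [cos B - cos y], and cosine is injective on [[0,PI]]. *)
Lemma critical_point (x y : R) :
  0 < y < PI -> Wx x y = 0 -> Wy x y = 0 -> A x y = x /\ B x y = y.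
Proof.
  intros Hy H1 H2.
  rewrite Wx_strip in H1 by lra. rewrite Wy_strip in H2 by lra.
  assert (K1 := B_monotone x y ltac:(lra)).
  assert (IB := B_interior x y Hy).
  assert (K2 : 0 < sin (B x y)) by (apply sin_gt_0; lra).
  assert (Ea : a x y = 0).
  { destruct (Rmult_integral _ _ H2) as [H|H]; [|lra].
    destruct (Rmult_integral _ _ H); lra. }
  split; [unfold a in Ea; lra|].
  rewrite Ea in H1. apply cos_inj; lra.
Qed.

Lemma weight_pos (x y : R) : 0 < y < PI -> 0 < weight x y.
Proof.
  intros Hy. assert (IB := B_interior x y Hy). unfold weight.
  apply Rplus_lt_0_compat; [apply sin_gt_0; lra|].
  apply Rmult_lt_0_compat; [apply sin_gt_0; lra|apply B_monotone; lra].
Qed.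

Lemma weight_nonneg (x y : R) : 0 <= y <= PI -> 0 <= weight x y.
Proof.
  intros Hy.
  destruct (Req_dec y 0) as [->|H0].
  { unfold weight. rewrite B_lower, sin_0. lra. }
  destruct (Req_dec y PI) as [->|H1].
  { unfold weight. rewrite B_upper, sin_PI. lra. }
  left. apply weight_pos; lra.
Qed.

(** Every interior point is critical, hence fixed. On the boundary [A x y = x] follows by
    continuity, and [B] is prescribed. *)
Lemma identity_of_W_eq_0 :
  (forall x y, 0 < y < PI -> W x y = 0) ->
  forall x y, 0 <= y <= PI -> A x y = x /\ B x y = y.
Proof.
  intros H0. assert (Pi := PI_RGT_0).
  assert (HI : forall x y, 0 < y < PI -> A x y = x /\ B x y = y).
  { intros x y Hy. apply critical_point; [exact Hy| |].
    - apply (is_derive_local_min (fun t => W t y) x); [apply is_derive_W_1|].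
      apply filter_forall. intros t. rewrite !H0 by exact Hy. lra.
    - apply (is_derive_local_min (fun t => W x t) y); [apply is_derive_W_2|].
      apply (locally_interval _ y 0 PI); simpl; try lra.
      intros t H1 H2. simpl in *. rewrite !H0 by lra. lra. }
  assert (HA : forall x y0, 0 <= y0 <= PI -> a x y0 = 0).
  { intros x y0 Hy0.
    destruct (Req_dec (a x y0) 0) as [E|E]; [exact E|exfalso].
    destruct (continuity_2d_pt_neq_0 a x y0 (Ca x y0) E) as [d Hd].
    assert (Pd := cond_pos d).
    (* [d / 2] keeps the moved point where [a] is nonzero; [PI / 4] keeps it interior when moving up
       from the lower half or down from the upper half. *)
    set (h := Rmin (d / 2) (PI / 4)).
    assert (h <= d / 2) by apply Rmin_l. assert (h <= PI / 4) by apply Rmin_r.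
    assert (0 < h) by (apply Rmin_glb_lt; lra).
    assert (exists t, 0 < t < PI /\ Rabs (t - y0) < d) as [t [It Ht]].
    { destruct (Rle_dec y0 (PI / 2)).
      - exists (y0 + h). split; [lra|]. apply Rabs_def1; lra.
      - exists (y0 - h). split; [lra|]. apply Rabs_def1; lra. }
    apply (Hd x t); [rewrite Rminus_diag, Rabs_R0; exact Pd|exact Ht|].
    destruct (HI x t It) as [K _]. unfold a. lra. }
  intros x y Hy. split; [assert (K := HA x y Hy); unfold a in K; lra|].
  destruct (Req_dec y 0) as [->|E0]; [apply B_lower|].
  destruct (Req_dec y PI) as [->|E1]; [apply B_upper|].
  apply HI; lra.
Qed.

(** The sign [e = 1] or [e = -1] treats minimum and maximum of [W] together, as a minimum of
    [e * W]. *)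
Lemma fixed_point (e : R) :
  e * e = 1 ->
  (exists x y, 0 <= y <= PI /\ ~ (A x y = x /\ B x y = y)) ->
  dint L (fun x y => e * (W x y * weight x y)) <= 0 ->
  exists x y, 0 < y < PI /\ A x y = x /\ B x y = y /\ e * s x y < 0.
Proof.
  intros He [u [v [Hv Hne]]] HI. assert (Pi := PI_RGT_0).
  assert (CeW : continuous_plane (fun x y => e * W x y)) by continuous_plane_tac.
  assert (HP : forall x y, 0 <= y <= PI ->
    exists x', 0 <= x' <= L /\ W x' y = W x y).
  { intros x y Hy. destruct (shift_to_period L x HL) as [n Hn].
    exists (x + IZR n * L). split; [exact Hn|].
    apply (periodic_shift L (fun t => W t y)). intros; now apply W_periodic. }
  destruct (rectangle_min (fun x y => e * W x y) 0 L 0 PI)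
    as [x0 [y0 [Hx0 [Hy0 Hmin]]]]; try lra; auto.
  assert (Hmin' : forall x y, 0 <= y <= PI -> e * W x0 y0 <= e * W x y).
  { intros x y Hy. destruct (HP x y Hy) as [x' [Hx' <-]]. now apply Hmin. }
  (* A negative minimum is interior, since [W] vanishes on the boundary. Otherwise [e * W >= 0], and
     its nonpositive weighted integral forces [W = 0] inside, hence the identity. *)
  destruct (Rlt_dec (e * W x0 y0) 0) as [Hneg|Hpos].
  - assert (Iy : 0 < y0 < PI).
    { destruct (Req_dec y0 0) as [E|E]; [rewrite E, W_lower in Hneg; lra|].
      destruct (Req_dec y0 PI) as [E'|E']; [rewrite E', W_upper in Hneg; lra|].
      lra. }
    assert (Z : forall w, e * w = 0 -> w = 0) by (intros w Hw; nra).
    assert (H1 : Wx x0 y0 = 0).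
    { apply Z, (is_derive_local_min (fun t => e * W t y0) x0).
      - apply (is_derive_scal (fun t => W t y0)), is_derive_W_1.
      - apply filter_forall. intros t. now apply Hmin'. }
    assert (H2 : Wy x0 y0 = 0).
    { apply Z, (is_derive_local_min (fun t => e * W x0 t) y0).
      - apply (is_derive_scal (fun t => W x0 t)), is_derive_W_2.
      - apply (locally_interval _ y0 0 PI); simpl; try lra.
        intros t Ht1 Ht2. simpl in *. apply Hmin'; lra. }
    destruct (critical_point x0 y0 Iy H1 H2) as [EA EB].
    exists x0, y0. repeat split; try tauto.
    (* At a fixed point [a = 0], so the action equals [W]. *)
    replace (s x0 y0) with (W x0 y0); [exact Hneg|].
    unfold W, a. rewrite EA. ring.
  - exfalso. apply Hne.
    apply identity_of_W_eq_0; [|exact Hv].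
    intros x y Hy. destruct (HP x y ltac:(lra)) as [x' [Hx' <-]].
    assert (K := dint_nonneg_eq_0 L (fun x y => e * (W x y * weight x y)) HL).
    specialize (K ltac:(apply continuous_plane_mult; [apply continuous_plane_const|];
      apply continuous_plane_mult; [exact CW|apply continuous_weight])).
    assert (K' : e * (W x' y * weight x' y) = 0).
    { apply K; try lra. intros p q Hp Hq.
      rewrite <- Rmult_assoc. apply Rmult_le_pos; [|now apply weight_nonneg].
      assert (J := Hmin' p q Hq). lra. }
    assert (J := weight_pos x' y Hy).
    assert (e <> 0) by (intros E; rewrite E in He; lra).
    destruct (Rmult_integral _ _ K') as [|K2]; [contradiction|].
    destruct (Rmult_integral _ _ K2); lra.
Qed.

Lemma strip_fixed_points :
  (exists x y, 0 <= y <= PI /\ ~ (A x y = x /\ B x y = y)) ->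
  (dint L (fun x y => s x y * sin y) <= 0 ->
     exists x y, 0 < y < PI /\ A x y = x /\ B x y = y /\ s x y < 0) /\
  (0 <= dint L (fun x y => s x y * sin y) ->
     exists x y, 0 < y < PI /\ A x y = x /\ B x y = y /\ 0 < s x y).
Proof.
  intros Hne. rewrite calabi_eq. split; intros H.
  - destruct (fixed_point 1) as [x [y K]]; [ring|exact Hne| |].
    + rewrite (dint_ext L _ (fun x y => W x y * weight x y)); [exact H|].
      intros; ring.
    + exists x, y. intuition lra.
  - destruct (fixed_point (-1)) as [x [y K]]; [ring|exact Hne| |].
    + assert (C : continuous_plane (fun x y => W x y * weight x y))
        by (apply continuous_plane_mult; [exact CW|apply continuous_weight]).
      assert (C' : continuous_plane (fun x y => -1 * (W x y * weight x y)))
        by (apply continuous_plane_mult; [apply continuous_plane_const|exact C]).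
      (* The integral of [-f] is obtained from additivity: the sum [-f + f] integrates to zero. *)
      assert (E := dint_plus L _ _ C' C).
      rewrite (dint_ext L _ (fun _ _ => 0)) in E; [|intros; ring].
      unfold dint at 1 in E. rewrite (RInt_ext _ (fun _ => 0)) in E.
      * rewrite RInt_const in E. unfold scal in E; simpl in E.
        unfold mult in E; simpl in E. lra.
      * intros. rewrite RInt_const. unfold scal; simpl. unfold mult; simpl. ring.
    + exists x, y. intuition lra.
Qed.

End Strip.

(** * From maps of the strip to their plane extensions *)

(** A boundary path starting on [y = 0] stays there: to reach [y = PI] it would have to cross
    [PI / 2]. On [y = 0] the form [lambda] is [dx]. *)
Lemma lambda_integral_lower (gamma : R -> R * R) (p q : R * R) :
  boundary_path gamma p q -> snd p = 0 -> lambda_integral gamma = fst q - fst p.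
Proof.
  intros [Hs [Hb [H0 H1]]] Hp. assert (Pi := PI_RGT_0).
  assert (Hc : continuity (fun t => snd (gamma t))).
  { intros t. apply continuity_pt_filterlim.
    apply (ex_derive_continuous (fun t => snd (gamma t))).
    apply (Hs 1%nat t). }
  assert (Z : forall t, 0 <= t <= 1 -> snd (gamma t) = 0).
  { intros t Ht. destruct (Hb t Ht) as [E|E]; [exact E|exfalso].
    destruct (IVT_gen (fun u => snd (gamma u)) 0 t (PI / 2)) as [z [Iz Ez]].
    - exact Hc.
    - rewrite H0, Hp, E, Rmin_left, Rmax_right; lra.
    - rewrite Rmin_left, Rmax_right in Iz by lra.
      destruct (Hb z ltac:(lra)); lra. }
  unfold lambda_integral. rewrite <- H0, <- H1.
  rewrite (RInt_ext _ (Derive (fun t => fst (gamma t)))).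
  - apply (RInt_Derive (fun t => fst (gamma t))); intros t _.
    + apply (Hs 1%nat t).
    + apply (ex_derive_continuous (Derive (fun t => fst (gamma t)))).
      apply (Hs 2%nat t).
  - intros t Ht. rewrite Rmin_left, Rmax_right in Ht by lra.
    rewrite Z, cos_0 by lra. apply Rmult_1_l.
Qed.

(** Horizontal lines through the strip stay in it, so [f] and [g] agree along the entire line, even
    on the boundary. *)
Lemma D1_extension (f : R * R -> R) (g : R -> R -> R) (p : R * R) :
  (forall q, strip q -> f q = g (fst q) (snd q)) -> strip p ->
  D1 f p = dx g (fst p) (snd p).
Proof. intros H Hp. apply Derive_ext. intros t. exact (H (t, snd p) Hp). Qed.

Lemma D2_smooth_extension (f : R * R -> R) (g : R -> R -> R) (p : R * R) :
  smooth_plane g -> (forall q, strip q -> f q = g (fst q) (snd q)) -> strip p ->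
  D2 f p = dy g (fst p) (snd p).
Proof.
  intros Hg H Hp. apply D2_extension; auto. apply (Hg 1%nat (fst p) (snd p)).
Qed.

Theorem theorem1p12 :
  forall (L : R) (Phi : R * R -> R * R) (sigma : R * R -> R),
    0 < L ->
    in_DL L Phi ->
    monotone Phi ->
    (exists p, strip p /\ Phi p <> p) ->
    FLUX L Phi = 0 ->
    is_action L Phi sigma ->
    (CAL L sigma <= 0 ->
       exists p, strip_interior p /\ Phi p = p /\ sigma p < 0) /\
    (0 <= CAL L sigma ->
       exists p, strip_interior p /\ Phi p = p /\ 0 < sigma p).
Proof.
  intros L Phi sigma HL HDL Hmono Hne Hflux Hact. assert (Pi := PI_RGT_0).
  destruct HDL as [[_ [[[A [SA EA]] [B [SB EB]]] _]] Heq Hlow Hup Hom].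
  destruct Hact as [[s [Ss Es]] HD1 HD2 [gamma [Hgamma Hbase]]].
  simpl in EA, EB.
  assert (EA' : forall x y, 0 <= y <= PI -> fst (Phi (x, y)) = A x y)
    by (intros x y Hy; exact (EA (x, y) Hy)).
  assert (EB' : forall x y, 0 <= y <= PI -> snd (Phi (x, y)) = B x y)
    by (intros x y Hy; exact (EB (x, y) Hy)).
  assert (Es' : forall x y, 0 <= y <= PI -> sigma (x, y) = s x y)
    by (intros x y Hy; exact (Es (x, y) Hy)).
  assert (A1 : forall x y, 0 <= y <= PI -> D1 (fun q => fst (Phi q)) (x, y) = dx A x y)
    by (intros x y Hy; exact (D1_extension _ A (x, y) EA Hy)).
  assert (B1 : forall x y, 0 <= y <= PI -> D1 (fun q => snd (Phi q)) (x, y) = dx B x y)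
    by (intros x y Hy; exact (D1_extension _ B (x, y) EB Hy)).
  assert (s1 : forall x y, 0 <= y <= PI -> D1 sigma (x, y) = dx s x y)
    by (intros x y Hy; exact (D1_extension _ s (x, y) Es Hy)).
  assert (A2 : forall x y, 0 <= y <= PI -> D2 (fun q => fst (Phi q)) (x, y) = dy A x y)
    by (intros x y Hy; exact (D2_smooth_extension _ A (x, y) SA EA Hy)).
  assert (B2 : forall x y, 0 <= y <= PI -> D2 (fun q => snd (Phi q)) (x, y) = dy B x y)
    by (intros x y Hy; exact (D2_smooth_extension _ B (x, y) SB EB Hy)).
  assert (s2 : forall x y, 0 <= y <= PI -> D2 sigma (x, y) = dy s x y)
    by (intros x y Hy; exact (D2_smooth_extension _ s (x, y) Ss Es Hy)).
  (* Positivity of this factor lets [CAL] and [FLUX] be replaced by plain integrals in sign and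
     vanishing conditions. *)
  assert (PL : 0 < / (2 * L)) by (apply Rinv_0_lt_compat; lra).
  assert (ECAL : CAL L sigma = / (2 * L) * dint L (fun x y => s x y * sin y)).
  { unfold CAL. f_equal. apply (dint_ext L (fun x y => sigma (x, y) * sin y)).
    intros x y Hy. rewrite Es' by lra. reflexivity. }
  destruct (strip_fixed_points L A B s HL SA SB Ss) as [K1 K2].
  - intros x y Hy. rewrite <- !EA', Heq by assumption. reflexivity.
  - intros x y Hy. rewrite <- !EB', Heq by assumption. reflexivity.
  - intros x. rewrite <- EB' by lra. apply Hlow.
  - intros x. rewrite <- EB' by lra. apply Hup.
  - intros x y Hy. rewrite <- EB', <- A1, <- A2, <- B1, <- B2 by exact Hy.
    exact (Hom (x, y) Hy).
  - intros x y Hy. rewrite <- B2 by exact Hy. exact (Hmono (x, y) Hy).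
  - intros x y Hy. rewrite <- s1, <- A1, <- EB' by exact Hy. exact (HD1 (x, y) Hy).
  - intros x y Hy. rewrite <- s2, <- A2, <- EB' by exact Hy. exact (HD2 (x, y) Hy).
  (* With zero flux, the action at the origin is the integral of [dx] along [gamma], that is
     [A 0 0]. *)
  - rewrite <- Es', <- EA', Hbase, Hflux by lra.
    rewrite (lambda_integral_lower _ _ _ Hgamma eq_refl). simpl. ring.
  - rewrite (dint_ext L _ (fun x y => (fst (Phi (x, y)) - x) * sin y)).
    + unfold FLUX in Hflux. destruct (Rmult_integral _ _ Hflux) as [E|E]; [lra|exact E].
    + intros x y Hy. rewrite EA' by lra. reflexivity.
  - destruct Hne as [[x y] [Hp Hne]]. exists x, y. split; [exact Hp|].
    intros [E1 E2]. apply Hne. rewrite <- EA' in E1 by exact Hp.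
    rewrite <- EB' in E2 by exact Hp. now apply injective_projections.
  - rewrite ECAL. split; intros H.
    + destruct K1 as [x [y [Hy [HA [HB Hs]]]]]; [nra|].
      exists (x, y). split; [exact Hy|]. split.
      * apply injective_projections; simpl; [rewrite EA'|rewrite EB']; lra.
      * rewrite Es'; lra.
    + destruct K2 as [x [y [Hy [HA [HB Hs]]]]]; [nra|].
      exists (x, y). split; [exact Hy|]. split.
      * apply injective_projections; simpl; [rewrite EA'|rewrite EB']; lra.
      * rewrite Es'; lra.
Qed.
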